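(* Let $\tilde A_i=(a_i;\,l_i^{\mu L},r_i^{\mu L},l_i^{\mu U},r_i^{\mu U};\,l_i^{\nu L},r_i^{\nu L},l_i^{\nu U},r_i^{\nu U})_{LR}$, $i=1,2$, be $LR$-type IVIFNs with the same shape functions, where $a_1-l_1^{\mu U}<0$ and $a_1-l_1^{\mu L}\ge0$, and $\tilde A_2$ is arbitrary. Then $\tilde A_1\odot\tilde A_2=(a;\,l^{\mu L},r^{\mu L},l^{\mu U},r^{\mu U};\,l^{\nu L},r^{\nu L},l^{\nu U},r^{\nu U})_{LR}$, where $a=a_1a_2$; for $\kappa=\mu L$, $$l^\kappa=a_1a_2-\min\{(a_1-l_1^\kappa)(a_2-l_2^\kappa),(a_1+r_1^\kappa)(a_2-l_2^\kappa)\},\quad r^\kappa=\max\{(a_1+r_1^\kappa)(a_2+r_2^\kappa),(a_1-l_1^\kappa)(a_2+r_2^\kappa)\}-a_1a_2;$$ and for each $\kappa\in\{\mu U,\nu L,\nu U\}$, $$l^\kappa=a_1a_2-\min\{(a_1-l_1^\kappa)(a_2+r_2^\kappa),(a_1+r_1^\kappa)(a_2-l_2^\kappa)\},\quad r^\kappa=\max\{(a_1+r_1^\kappa)(a_2+r_2^\kappa),(a_1-l_1^\kappa)(a_2-l_2^\kappa)\}-a_1a_2.$$ Moreover the conditions for an $LR$-type representation hold: all eight spreads of the product are positive and $l^{\mu U}\ge l^{\mu L}$, $l^{\nu L}\ge l^{\nu U}$, $l^{\nu L}\ge l^{\mu L}$, $l^{\nu U}\ge l^{\mu U}$, and likewise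 with $r$ in place of $l$.
   Context: A shape function is a continuous, strictly decreasing, invertible $f:[0,\infty)\to[0,1]$ with $f(0)=1$ and $\lim_{x\to\infty}f(x)=0$. Fix shape functions $L,R,L',R'$. An $LR$-type interval-valued intuitionistic fuzzy number (IVIFN) is written $\tilde A=(a;l^{\mu L},r^{\mu L},l^{\mu U},r^{\mu U};l^{\nu L},r^{\nu L},l^{\nu U},r^{\nu U})_{LR}$, where $a\in\mathbb R$ is its mean value and the eight spreads are positive reals with $l^{\mu U}\ge l^{\mu L}$, $r^{\mu U}\ge r^{\mu L}$, $l^{\nu L}\ge l^{\nu U}$, $r^{\nu L}\ge r^{\nu U}$, $l^{\nu L}\ge l^{\mu L}$, $r^{\nu L}\ge r^{\mu L}$, $l^{\nu U}\ge l^{\mu U}$, $r^{\nu U}\ge r^{\mu U}$. It encodes a lower membership function equal to $L((a-x)/l^{\mu L})$ on $[a-l^{\mu L},a]$, $R((x-a)/r^{\mu L})$ on $[a,a+r^{\mu L}]$, and $0$ otherwise; an upper membership function of the same form with $L',R',l^{\mu U},r^{\mu U}$; a lower non-membership function equal to $1-L((a-x)/l^{\nu L})$ on $[a-l^{\nu L},a]$, $1-R((x-a)/r^{\nu L})$ on $[a,a+r^{\nu L}]$, and $1$ otherwise; and an upper non-membership function of the same form with $L',R',l^{\nu U},r^{\nu U}$. At each $x$ the supremum of the membership interval plus the supremum of the non-membership interval is at most $1$. The product $\tilde A_1\odot\tilde A_2$ is formed cutwise by interval multiplication and read off at the level where the inverse shape functions equal $0$ (giving the mean) and at the level where they equal $1$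 (giving the spreads). That is, it is the tuple (with the same shape functions) with mean $a=a_1a_2$ and spreads determined, for each $\kappa\in\{\mu L,\mu U,\nu L,\nu U\}$, by $$[a-l^{\kappa},a+r^{\kappa}]=[a_1-l_1^{\kappa},a_1+r_1^{\kappa}]\times[a_2-l_2^{\kappa},a_2+r_2^{\kappa}],$$ where $I\times J=\{xy:x\in I,y\in J\}$. *)

(* Defs.v *)
From HB Require Import structures.
From mathcomp Require Import all_boot all_order all_algebra.
From mathcomp Require Import all_classical all_reals all_analysis.
Set Implicit Arguments.
Unset Strict Implicit.
Unset Printing Implicit Defensive.
Import Order.TTheory GRing.Theory Num.Theory.
Import numFieldNormedType.Exports.
Local Open Scope classical_set_scope.
Local Open Scope ring_scope.

(** A function on [0, +oo) is represented by a total function; its values at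
    negative arguments are never used.  Strict monotonicity and the limit 0 force
    the value 0 to be missed, so "invertible" is read as bijectivity onto (0, 1]. *)
Record shape_function (R : realType) (f : R -> R) : Prop := ShapeFunction {
  shape_range : forall x, 0 <= x -> 0 <= f x <= 1;
  shape_continuous : {within `[0, +oo[, continuous f};
  shape_decreasing : {in `[0, +oo[ &, forall x y, x < y -> f y < f x};
  shape_invertible : set_bij `[0, +oo[ `]0, 1] f;
  shape_at0 : f 0 = 1;
  shape_lim : f x @[x --> +oo] --> 0 }.

Inductive component := muL | muU | nuL | nuU.

(** Fields in the order of the tuple
    (a; l^muL, r^muL, l^muU, r^muU; l^nuL, r^nuL, l^nuU, r^nuU). *)
Record LR_tuple (R : realType) := LRTuple {
  mean : R;
  l_muL : R; r_muL : R; l_muU : R; r_muU : R;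
  l_nuL : R; r_nuL : R; l_nuU : R; r_nuU : R }.

Definition lspread (R : realType) (A : LR_tuple R) (k : component) : R :=
  match k with
  | muL => l_muL A | muU => l_muU A | nuL => l_nuL A | nuU => l_nuU A
  end.

Definition rspread (R : realType) (A : LR_tuple R) (k : component) : R :=
  match k with
  | muL => r_muL A | muU => r_muU A | nuL => r_nuL A | nuU => r_nuU A
  end.

Definition LR_membership (R : realType) (f g : R -> R) (a l r x : R) : R :=
  if a - l <= x <= a then f ((a - x) / l)
  else if a <= x <= a + r then g ((x - a) / r)
  else 0.

Definition LR_nonmembership (R : realType) (f g : R -> R) (a l r x : R) : R :=
  if a - l <= x <= a then 1 - f ((a - x) / l)
  else if a <= x <= a + r then 1 - g ((x - a) / r)
  else 1.

(** No pointwise order between the lower and the upper function is required, so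
    this interval may be empty at some points; its [sup] is then 0. *)
Definition membership_interval (R : realType) (fL fR fL' fR' : R -> R)
    (A : LR_tuple R) (x : R) : set R :=
  `[LR_membership fL fR (mean A) (l_muL A) (r_muL A) x,
    LR_membership fL' fR' (mean A) (l_muU A) (r_muU A) x].

Definition nonmembership_interval (R : realType) (fL fR fL' fR' : R -> R)
    (A : LR_tuple R) (x : R) : set R :=
  `[LR_nonmembership fL fR (mean A) (l_nuL A) (r_nuL A) x,
    LR_nonmembership fL' fR' (mean A) (l_nuU A) (r_nuU A) x].

Definition spread_conditions (R : realType) (A : LR_tuple R) : Prop :=
  [/\ forall k, 0 < lspread A k /\ 0 < rspread A k,
      l_muL A <= l_muU A /\ r_muL A <= r_muU A,
      l_nuU A <= l_nuL A /\ r_nuU A <= r_nuL A,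
      l_muL A <= l_nuL A /\ r_muL A <= r_nuL A
    & l_muU A <= l_nuU A /\ r_muU A <= r_nuU A].

Definition LR_IVIFN (R : realType) (fL fR fL' fR' : R -> R)
    (A : LR_tuple R) : Prop :=
  spread_conditions A /\
  forall x, sup (membership_interval fL fR fL' fR' A x) +
            sup (nonmembership_interval fL fR fL' fR' A x) <= 1.

Definition support (R : realType) (A : LR_tuple R) (k : component) : set R :=
  `[mean A - lspread A k, mean A + rspread A k].

(** [is_product A1 A2 A] : the tuple [A] is the product of [A1] and [A2]. *)
Definition is_product (R : realType) (A1 A2 A : LR_tuple R) : Prop :=
  mean A = mean A1 * mean A2 /\
  forall k, support A k =
    [set x * y | x in support A1 k & y in support A2 k].

(* Main.v *)
(** The product of two intervals is the interval between its extreme values, by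
    the intermediate value theorem along a segment of the rectangle; these
    extremes are attained at corners selected by the signs of the end points of
    the first factor.  Hence the supports of the product are nested as those of
    the factors are, which yields the spread conditions.  Together with the
    monotonicity of the shape functions, the inequalities
    [l^muU <= l^nuU] and [r^muU <= r^nuU] alone bound the sum of the suprema. *)
Require Import Defs.
From HB Require Import structures.
From mathcomp Require Import all_boot all_order all_algebra.
From mathcomp Require Import all_classical all_reals all_analysis.
From mathcomp Require Import lra.
Import Order.TTheory GRing.Theory Num.Theory.
Import numFieldNormedType.Exports.
Local Open Scope classical_set_scope.
Local Open Scope ring_scope.

(** * Products of two closed intervals *)

Section IntervalProduct.
Context {R : realType}.
Implicit Types p q c d m M x y z : R.

Lemma itv_mul_connected {p q c d x1 y1 x2 y2 z} :
  p <= x1 <= q -> c <= y1 <= d -> p <= x2 <= q -> c <= y2 <= d ->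
  x1 * y1 <= z <= x2 * y2 ->
  exists x, exists y, [/\ p <= x <= q, c <= y <= d & x * y = z].
Proof.
move=> /andP[px1 x1q] /andP[cy1 y1d] /andP[px2 x2q] /andP[cy2 y2d] /andP[z1 z2].
(* Product of the coordinates along the segment from [(x1, y1)] to [(x2, y2)]; by convexity this
   segment stays in the rectangle. *)
pose g t := (x1 + t * (x2 - x1)) * (y1 + t * (y2 - y1)).
have cg : {within `[0, 1], continuous g}.
  apply: continuous_subspaceT => t.
  by apply: cvgM; apply: cvgD (cvg_cst _) (cvgM cvg_id (cvg_cst _)).
have g0 : g 0 = x1 * y1 by rewrite /g !mul0r !addr0.
have g1 : g 1 = x2 * y2 by rewrite /g !mul1r !subrKC.
have [|t] := IVT (v := z) ler01 cg.
  by rewrite g0 g1 ge_min le_max z1 z2 orbT.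
rewrite in_itv /= => /andP[t0 t1] gt.
by exists (x1 + t * (x2 - x1)), (y1 + t * (y2 - y1)); split=> //;
  apply/andP; split; nra.
Qed.

Lemma itv_mulE {p q c d m M} :
  (forall x y, p <= x <= q -> c <= y <= d -> m <= x * y <= M) ->
  (exists x, exists y, [/\ p <= x <= q, c <= y <= d & x * y = m]) ->
  (exists x, exists y, [/\ p <= x <= q, c <= y <= d & x * y = M]) ->
  `[m, M]%classic = [set x * y | x in `[p, q] & y in `[c, d]].
Proof.
move=> bnd [x1 [y1 [x1P y1P m1]]] [x2 [y2 [x2P y2P M2]]].
apply/seteqP; split=> z /=.
  rewrite in_itv -m1 -M2 /= => zP.
  have [x [y [xP yP <-]]] := itv_mul_connected x1P y1P x2P y2P zP.
  by exists x; rewrite /= ?in_itv //; exists y; rewrite /= ?in_itv.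
move=> [x /= xP [y /= yP <-]]; move: xP yP; rewrite !in_itv /=; exact: bnd.
Qed.

(** For fixed [y] the product is monotone in [x], in a direction given by the sign of [y]; [min] and
    [max] cover both directions. *)
Lemma mul_between {p q x} y : p <= x <= q ->
  Num.min (p * y) (q * y) <= x * y <= Num.max (p * y) (q * y).
Proof.
move=> /andP[px xq]; rewrite ge_min le_max.
have [y0|y0] := leP 0 y; last move/ltW in y0.
  by rewrite (ler_wpM2r y0 px) (ler_wpM2r y0 xq) orbT.
by rewrite (ler_wnM2r y0 px) (ler_wnM2r y0 xq) !orbT.
Qed.

(** Once [x] is moved to an end point, multiplication by [p] or [q] preserves order, so [y] moves to
    [c] for the minimum and to [d] for the maximum. *)
Lemma itv_mul_nonneg {p q c d} : 0 <= p -> p <= q -> c <= d ->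
  `[Num.min (p * c) (q * c), Num.max (q * d) (p * d)]%classic =
  [set x * y | x in `[p, q] & y in `[c, d]].
Proof.
move=> p0 pq cd; have q0 := le_trans p0 pq.
apply: itv_mulE => [x y xP /andP[cy yd]| |].
- have /andP[h1 h2] := mul_between y xP; apply/andP; split.
    by apply: le_trans h1; rewrite le_min !ge_min
      (ler_wpM2l p0 cy) (ler_wpM2l q0 cy) orbT.
  by apply: (le_trans h2); rewrite ge_max !le_max
      (ler_wpM2l p0 yd) (ler_wpM2l q0 yd) orbT.
- by case: leP => _; [exists p|exists q]; exists c; rewrite !lexx pq cd.
- by case: leP => _; [exists p|exists q]; exists d; rewrite !lexx pq cd.
Qed.

(** Multiplication by [p] now reverses order, so [p] pairs with [d] in the minimum and with [c] in
    the maximum. *)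
Lemma itv_mul_mixed {p q c d} : p <= 0 -> 0 <= q -> c <= d ->
  `[Num.min (p * d) (q * c), Num.max (q * d) (p * c)]%classic =
  [set x * y | x in `[p, q] & y in `[c, d]].
Proof.
move=> p0 q0 cd; have pq := le_trans p0 q0.
apply: itv_mulE => [x y xP /andP[cy yd]| |].
- have /andP[h1 h2] := mul_between y xP; apply/andP; split.
    by apply: le_trans h1; rewrite le_min !ge_min
      (ler_wnM2l p0 yd) (ler_wpM2l q0 cy) orbT.
  by apply: (le_trans h2); rewrite ge_max !le_max
      (ler_wnM2l p0 cy) (ler_wpM2l q0 yd) orbT.
- case: leP => _; [exists p, d|exists q, c]; by rewrite !lexx pq cd.
- case: leP => _; [exists p, c|exists q, d]; by rewrite !lexx pq cd.
Qed.

End IntervalProduct.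

(** * Supports of a product: uniqueness, nesting, positivity of the spreads *)

Section Product.
Context {R : realType}.
Implicit Types A B : LR_tuple R.

(** Nonemptiness of the support, which is available for a product before its spreads are known to be
    positive. *)
Definition endpoints_ordered A k :=
  mean A - lspread A k <= mean A + rspread A k.

Lemma spread_conditions_ordered A k :
  spread_conditions A -> endpoints_ordered A k.
Proof. by case=> /(_ k)[l0 r0] _ _ _ _; rewrite /endpoints_ordered; lra. Qed.

Lemma supportP A k x : Defs.support A k x <->
  mean A - lspread A k <= x <= mean A + rspread A k.
Proof. by rewrite /Defs.support /= in_itv. Qed.

Lemma mean_support A k : spread_conditions A -> Defs.support A k (mean A).
Proof. by case=> /(_ k)[l0 r0] _ _ _ _; apply/supportP; lra. Qed.

Lemma sub_support A k j :
  lspread A k <= lspread A j -> rspread A k <= rspread A j ->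
  Defs.support A k `<=` Defs.support A j.
Proof.
by move=> ll rr x /supportP/andP[x1 x2]; apply/supportP/andP; split; lra.
Qed.

(** A nonempty support contains its own end points; with equal means, their position in the larger
    support compares the spreads. *)
Lemma support_subE A B k j : endpoints_ordered A k -> mean A = mean B ->
  Defs.support A k `<=` Defs.support B j ->
  lspread A k <= lspread B j /\ rspread A k <= rspread B j.
Proof.
rewrite /endpoints_ordered => lr ab AB.
have /AB/supportP/andP[] : Defs.support A k (mean A - lspread A k).
  by apply/supportP; rewrite lexx.
have /AB/supportP/andP[] : Defs.support A k (mean A + rspread A k).
  by apply/supportP; rewrite lexx lr.
by move: ab => ->; split; lra.
Qed.

Lemma LR_tuple_eq A B : mean A = mean B ->
  (forall k, lspread A k = lspread B k) ->
  (forall k, rspread A k = rspread B k) -> A = B.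
Proof.
case: A B => [a l1 r1 l2 r2 l3 r3 l4 r4] [b l1' r1' l2' r2' l3' r3' l4' r4'].
move=> /= -> hl hr; congr LRTuple; [exact: (hl muL)|exact: (hr muL)|
  exact: (hl muU)|exact: (hr muU)|exact: (hl nuL)|exact: (hr nuL)|
  exact: (hl nuU)|exact: (hr nuU)].
Qed.

Section Fixed.
Variables A1 A2 : LR_tuple R.
Hypotheses (s1 : spread_conditions A1) (s2 : spread_conditions A2).

Lemma product_mul_support {A k x y} : is_product A1 A2 A ->
  Defs.support A1 k x -> Defs.support A2 k y -> Defs.support A k (x * y).
Proof. by move=> [_ ->] hx hy; exists x => //; exists y. Qed.

(** The support of the product contains the product of the means. *)
Lemma product_ordered {A k} : is_product A1 A2 A -> endpoints_ordered A k.
Proof.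
move=> AP; have /supportP/andP[] := product_mul_support AP
  (mean_support _ k s1) (mean_support _ k s2).
exact: le_trans.
Qed.

Lemma product_unique {A B} :
  is_product A1 A2 A -> is_product A1 A2 B -> A = B.
Proof.
move=> AP BP; have mAB : mean A = mean B by rewrite AP.1 BP.1.
have sAB k : Defs.support A k = Defs.support B k by rewrite AP.2 BP.2.
have le k : lspread A k = lspread B k /\ rspread A k = rspread B k.
  have [|l1 r1] := support_subE _ _ k k (product_ordered AP) mAB.
    by rewrite sAB.
  have [|l2 r2] := support_subE _ _ k k (product_ordered BP) (esym mAB).
    by rewrite sAB.
  by split; apply/le_anti/andP.
by apply: LR_tuple_eq => // k; have [] := le k.
Qed.

Lemma product_mono {A k j} : is_product A1 A2 A ->
  lspread A1 k <= lspread A1 j /\ rspread A1 k <= rspread A1 j ->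
  lspread A2 k <= lspread A2 j /\ rspread A2 k <= rspread A2 j ->
  lspread A k <= lspread A j /\ rspread A k <= rspread A j.
Proof.
move=> AP [l1 r1] [l2 r2]; apply: support_subE (product_ordered AP) _ _ => //.
rewrite AP.2 => _ [x xP [y yP <-]].
by apply: (product_mul_support AP); [move: xP|move: yP]; exact: sub_support.
Qed.

Lemma product_spread_conditions {A} : 0 < mean A1 ->
  is_product A1 A2 A -> spread_conditions A.
Proof.
move=> a0 AP; case: (s1) => _ q1 q2 q3 q4; case: (s2) => t0 t1 t2 t3 t4.
split; last 4 first.
- exact: (product_mono (k := muL) (j := muU) AP).
- exact: (product_mono (k := nuU) (j := nuL) AP).
- exact: (product_mono (k := muL) (j := nuL) AP).
- exact: (product_mono (k := muU) (j := nuU) AP).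
move=> k; have [l0 r0] := t0 k.
(* With the first factor fixed at its positive mean, the end points of the second give products
   strictly on either side of the mean of [A]. *)
have lo : Defs.support A2 k (mean A2 - lspread A2 k) by apply/supportP; lra.
have hi : Defs.support A2 k (mean A2 + rspread A2 k) by apply/supportP; lra.
have /supportP/andP[+ _] := product_mul_support AP (mean_support _ k s1) lo.
have /supportP/andP[_] := product_mul_support AP (mean_support _ k s1) hi.
by rewrite AP.1; have := mulr_gt0 a0 l0; have := mulr_gt0 a0 r0; split; lra.
Qed.

End Fixed.
End Product.

(** * Membership functions and the bound on the suprema *)

Section Shape.
Context {R : realType}.
Implicit Types (f g : R -> R) (a l r x : R).

Lemma shape_le {f} x y : shape_function f -> 0 <= x -> x <= y -> f y <= f x.
Proof.
move=> hf x0; rewrite le_eqVlt => /predU1P[->//|xy].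
by apply/ltW/(shape_decreasing hf); rewrite ?in_itv /= ?andbT //; lra.
Qed.

Lemma div_spread_ge0 {u l : R} : 0 < l -> 0 <= u -> 0 <= u / l.
Proof. by move=> l0 u0; rewrite divr_ge0 // ltW. Qed.

Lemma LR_nonmembershipE f g a l r x :
  LR_nonmembership f g a l r x = 1 - LR_membership f g a l r x.
Proof.
by rewrite /LR_nonmembership /LR_membership; do 2 case: ifP => //; rewrite subr0.
Qed.

Lemma LR_membership_range {f g} a {l r} x :
  shape_function f -> shape_function g -> 0 < l -> 0 < r ->
  0 <= LR_membership f g a l r x <= 1.
Proof.
move=> hf hg l0 r0; rewrite /LR_membership.
case: ifP => [/andP[x1 x2]|_].
  by apply: (shape_range hf); apply: div_spread_ge0; lra.
case: ifP => [/andP[x1 x2]|_]; last by rewrite lexx ler01.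
by apply: (shape_range hg); apply: div_spread_ge0; lra.
Qed.

(** A larger spread widens the support and shrinks the argument of a decreasing shape function. *)
Lemma LR_membership_mono {f g} a {l r l' r'} x :
  shape_function f -> shape_function g -> 0 < l -> 0 < r ->
  l <= l' -> r <= r' ->
  LR_membership f g a l r x <= LR_membership f g a l' r' x.
Proof.
move=> hf hg l0 r0 ll rr.
have l'0 := lt_le_trans l0 ll; have r'0 := lt_le_trans r0 rr.
rewrite {1}/LR_membership; case: ifP => [/andP[x1 x2]|nl].
  rewrite /LR_membership ifT; last by apply/andP; split; lra.
  apply: shape_le => //; first by apply: div_spread_ge0; lra.
  by rewrite ler_wpM2l ?lef_pV2 ?posrE //; lra.
case: ifP => [/andP[x1 x2]|_]; last first.
  by have /andP[] := LR_membership_range a x hf hg l'0 r'0.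
(* At [x = a] the left branch applies; strictness puts both functions in their right branch. *)
have ax : a < x.
  rewrite lt_neqAle x1 andbT; apply: contraFN nl => /eqP <-.
  by rewrite lexx andbT; lra.
rewrite /LR_membership ifF; last by apply/negbTE; rewrite negb_and -!ltNge ax orbT.
rewrite ifT; last by apply/andP; split; lra.
apply: shape_le => //; first by apply: div_spread_ge0; lra.
by rewrite ler_wpM2l ?lef_pV2 ?posrE //; lra.
Qed.

(** If [v < u] the interval is empty and its [sup] is 0, hence the sign condition. *)
Lemma sup_itv_le {u v : R} : 0 <= v -> sup `[u, v] <= v.
Proof.
have [uv|vu v0] := leP u v; first by rewrite sup_itvcc.
by rewrite set_itv_ge ?sup0 // bnd_simp -ltNge.
Qed.

Lemma LR_IVIFN_of_spreads {fL fR fL' fR' : R -> R} {A : LR_tuple R} :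
  shape_function fL' -> shape_function fR' ->
  spread_conditions A -> LR_IVIFN fL fR fL' fR' A.
Proof.
move=> hf hg sA; split=> // x.
have [pos _ _ _ [ll rr]] := sA.
have [l0 r0] := pos muU; have [l'0 r'0] := pos nuU.
rewrite /membership_interval /nonmembership_interval !LR_nonmembershipE.
have mono := LR_membership_mono (mean A) x hf hg l0 r0 ll rr.
have /andP[mu0 _] := LR_membership_range (mean A) x hf hg l0 r0.
have /andP[_ nu1] := LR_membership_range (mean A) x hf hg l'0 r'0.
rewrite /= in mono mu0 nu1.
by apply: le_trans (lerD (sup_itv_le _) (sup_itv_le _)) _; lra.
Qed.

End Shape.

Theorem proposition3p1p5 (R : realType) (fL fR fL' fR' : R -> R)
    (hfL : shape_function fL) (hfR : shape_function fR)
    (hfL' : shape_function fL') (hfR' : shape_function fR')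
    (A1 A2 : LR_tuple R)
    (hA1 : LR_IVIFN fL fR fL' fR' A1) (hA2 : LR_IVIFN fL fR fL' fR' A2)
    (hneg : mean A1 - l_muU A1 < 0) (hnneg : 0 <= mean A1 - l_muL A1) :
  let a1 := mean A1 in let a2 := mean A2 in
  let l1 := lspread A1 in let r1 := rspread A1 in
  let l2 := lspread A2 in let r2 := rspread A2 in
  let l_pos k := a1 * a2 - Num.min ((a1 - l1 k) * (a2 - l2 k))
                                   ((a1 + r1 k) * (a2 - l2 k)) in
  let r_pos k := Num.max ((a1 + r1 k) * (a2 + r2 k))
                         ((a1 - l1 k) * (a2 + r2 k)) - a1 * a2 in
  let l_mix k := a1 * a2 - Num.min ((a1 - l1 k) * (a2 + r2 k))
                                   ((a1 + r1 k) * (a2 - l2 k)) in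
  let r_mix k := Num.max ((a1 + r1 k) * (a2 + r2 k))
                         ((a1 - l1 k) * (a2 - l2 k)) - a1 * a2 in
  let P := LRTuple (a1 * a2)
             (l_pos muL) (r_pos muL) (l_mix muU) (r_mix muU)
             (l_mix nuL) (r_mix nuL) (l_mix nuU) (r_mix nuU) in
  (forall A : LR_tuple R, is_product A1 A2 A <-> A = P) /\
  LR_IVIFN fL fR fL' fR' P.
Proof.
move=> a1 a2 l1 r1 l2 r2 l_pos r_pos l_mix r_mix P.
have [[s1 _] [s2 _]] := (hA1, hA2).
have [p1 _ [nl _] _ [ml _]] := s1.
(* The mean is at least [l_muL A1], which is positive. *)
have a10 : 0 < mean A1 by have [/= + _] := p1 muL; lra.
have PP : is_product A1 A2 P.
  split=> // k; rewrite /Defs.support.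
  have cd := spread_conditions_ordered _ k s2.
  have [/= l0 r0] := p1 k; have q0 : 0 <= a1 + r1 k by rewrite /a1 /r1; lra.
  case: k l0 r0 q0 cd => l0 r0 q0 cd; rewrite /= !subKr !subrKC.
  - by apply: itv_mul_nonneg => //; rewrite /a1 /l1 /r1 /=; move: l0 r0 => /=; lra.
  (* For the other three components the left spread is at least [l_muU A1], so [hneg] makes the left
     end point negative. *)
  - by apply: itv_mul_mixed => //; rewrite /a1 /l1 /=; lra.
  - by apply: itv_mul_mixed => //; rewrite /a1 /l1 /=; lra.
  - by apply: itv_mul_mixed => //; rewrite /a1 /l1 /=; lra.
split; last first.
  by apply: LR_IVIFN_of_spreads => //; exact: product_spread_conditions PP.
by move=> A; split=> [AP|->//]; exact: product_unique PP.
Qed.
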